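(* Let $G$ be a finite group with unit element $e$ and with an involution $I:G\to G$. Then the elements of $G$ under the product $a\cdot b := I(b)a$ form a quasigroup with a right unit element, namely $\tau=e$. That is: for all $a,b\in G$ there is a unique $x\in G$ with $a\cdot x=b$ and a unique $y\in G$ with $y\cdot a=b$, and $a\cdot\tau=a$ for all $a\in G$.
   Context: An involution on a finite group $G$ with unit $e$ is a map $I:G\to G$ such that $I(I(g))=g$ for all $g\in G$, $I(g_1g_2\cdots g_p)=I(g_p)\cdots I(g_2)I(g_1)$ for all $g_1,\dots,g_p\in G$, and $I(e)=e$ (and also $I(-e)=-e$ if $G$ has a designated element denoted $-e$). The ''dot'' product on $G$ is defined by $a\cdot b:=I(b)a$, where the right-hand side is the product of the group $G$. The symbol $\tau$ denotes the element $e$ of $G$ regarded as an element under the dot product. *)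

(* Defs.v *)
From HB Require Import structures.
From mathcomp Require Import all_boot all_fingroup.

Set Implicit Arguments.
Unset Strict Implicit.
Unset Printing Implicit Defensive.

Local Open Scope group_scope.

(* [me] is the element written -e, when the group has a designated one;      *)
(* [None] means that no such element is designated.                          *)
Definition is_involution (gT : finGroupType) (me : option gT) (I : gT -> gT) :
    Prop :=
  [/\ involutive I,
      forall s : seq gT, I (\prod_(g <- s) g) = \prod_(g <- rev s) I g,
      I 1 = 1
    & forall m : gT, me = Some m -> I m = m].

Definition dot (gT : finGroupType) (I : gT -> gT) (a b : gT) : gT := I b * a.

Definition tau (gT : finGroupType) : gT := 1.

Definition is_quasigroup (T : Type) (op : T -> T -> T) : Prop :=
  forall a b : T, (exists! x : T, op a x = b) /\ (exists! y : T, op y a = b).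

(* Main.v *)
Require Import Defs.
From mathcomp Require Import all_boot all_fingroup.

(** Each of the maps [x |-> I x * a] and [y |-> I a * y] is a bijection of the
    group: the second is a translation, and the first is [I], which is its own
    inverse, followed by a translation. Inverting them gives the solutions
    [I (b * a^-1)] and [(I a)^-1 * b]. The unit is on the right because [I]
    fixes [1] and acts on the right factor of the dot product. *)

Theorem corollary2p9 (gT : finGroupType) (me : option gT) (I : gT -> gT)
    (hI : is_involution me I) :
  is_quasigroup (dot I) /\ right_id (tau gT) (dot I).
Proof.
case: hI => IK _ I1 _; split; last by move=> a; rewrite /dot /tau I1 mul1g.
move=> a b; rewrite /dot; split.
- exists (I (b * a^-1)%g); split; first by rewrite IK mulgKV.
  by move=> x <-; rewrite mulgK IK.
- exists ((I a)^-1 * b)%g; split; first by rewrite mulKVg.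
  by move=> y <-; rewrite mulKg.
Qed.
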